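(* For every positive integer $n$, the operator $\mathscr R_n$ on ai-semiring varieties is right adjoint to $\mathscr M_n$; explicitly, for all ai-semiring varieties $\mathcal V,\mathcal W$, $$\mathscr M_n(\mathcal V)\le\mathcal W\quad\Longleftrightarrow\quad\mathcal V\le\mathscr R_n(\mathcal W).$$ Moreover, for all positive integers $m,n$ and every ai-semiring variety $\mathcal W$, $$\mathscr R_m\mathscr R_n=\mathscr R_{mn},\qquad \mathscr R_n(\mathcal W)\le\mathcal W.$$ The variety $$\operatorname{Core}(\mathcal W)=\bigcap_{k\ge0}\mathscr R_{2^k}(\mathcal W)$$ is the greatest matrix-stable subvariety of $\mathcal W$.
   Context: An additively idempotent semiring (ai-semiring) is an algebra $(S,+,\cdot)$ in the signature of two binary operations with $(S,+)$ a commutative idempotent semigroup, $(S,\cdot)$ a semigroup, and multiplication distributing over addition on both sides. For an ai-semiring $S$ and $n\ge1$, $M_n(S)$ is the ai-semiring of all $n\times n$ matrices over $S$ with entrywise addition and usual matrix multiplication. Varieties are ordered by inclusion $\le$. For an ai-semiring variety $\mathcal V$ and $n\ge1$, $\mathscr M_n(\mathcal V)$ is the variety generated by $\{M_n(S):S\in\mathcal V\}$. For an ai-semiring variety $\mathcal W$, $\mathscr R_n(\mathcal W)=\{S: S\text{ an ai-semiring with }M_n(S)\in\mathcal W\}$, which is itself a variety. A variety $\mathcal V$ is matrix-stable if $\mathscr M_n(\mathcal V)=\mathcal V$ for every $n\ge1$. *)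

(* Defs.v *)
From HB Require Import structures.
From mathcomp Require Import all_boot matrix.
From mathcomp Require Import boolp.

Set Implicit Arguments.
Unset Strict Implicit.
Unset Printing Implicit Defensive.

Declare Scope ai_scope.
Delimit Scope ai_scope with AI.

(* Neither a zero nor a unit is assumed, so this is not one of the library's
   semirings.  As usual in universal algebra, the carrier is nonempty. *)
HB.mixin Record isAiSemiring S := {
  aiadd : S -> S -> S;
  aimul : S -> S -> S;
  aiaddA : associative aiadd;
  aiaddC : commutative aiadd;
  aiaddxx : idempotent_op aiadd;
  aimulA : associative aimul;
  aimulDl : left_distributive aimul aiadd;
  aimulDr : right_distributive aimul aiadd;
  ai_inhabited : inhabited S
}.

#[short(type="aiSemiringType")]
HB.structure Definition AiSemiring := {S of isAiSemiring S}.

Notation "x + y" := (aiadd x y) : ai_scope.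
Notation "x * y" := (aimul x y) : ai_scope.
Local Open Scope ai_scope.

HB.instance Definition _ (S : aiSemiringType) :=
  SemiGroup.isComLaw.Build S (@aiadd S) (@aiaddA S) (@aiaddC S).

Section NonemptySum.
Variables (S : aiSemiringType) (I : finType).
Implicit Types (i : I) (F G : I -> S).

(* The sum of all [F k], [k : I].  Without a zero it has to start from one of
   its terms; by [nesum_indep] the choice of that term [i] is irrelevant. *)
Definition nesum i F : S := \big[@aiadd S/F i]_(k | k != i) F k.

Local Notation oadd := (oAC (@aiaddA S) (@aiaddC S)).

Lemma some_nesum i F :
  Some (nesum i F) = \big[oadd/None]_k Some (F k).
Proof.
rewrite (bigD1 i) //= /nesum (some_big_AC_mk_monoid (@aiaddA S) (@aiaddC S)).
exact: (Monoid.mulmC oadd).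
Qed.

Lemma nesum_indep i j F : nesum i F = nesum j F.
Proof. by apply: Some_inj; rewrite !some_nesum. Qed.

Lemma eq_nesum i F G : F =1 G -> nesum i F = nesum i G.
Proof. by move=> eqFG; rewrite /nesum eqFG; apply: eq_bigr. Qed.

Lemma nesum_add i F G :
  nesum i (fun k => F k + G k) = nesum i F + nesum i G.
Proof.
apply: Some_inj.
rewrite -[RHS]/(oadd (Some (nesum i F)) (Some (nesum i G))) !some_nesum -big_split.
exact: eq_bigr.
Qed.

Lemma nesum_mull i F x : nesum i F * x = nesum i (fun k => F k * x).
Proof. by apply: (big_morph (fun y => y * x)) => // y z; apply: aimulDl. Qed.

Lemma nesum_mulr i F x : x * nesum i F = nesum i (fun k => x * F k).
Proof. by apply: (big_morph (fun y => x * y)) => // y z; apply: aimulDr. Qed.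

End NonemptySum.

Lemma nesum_exchange (S : aiSemiringType) (I J : finType) i j
    (F : I -> J -> S) :
  nesum i (fun k => nesum j (F k)) = nesum j (fun l => nesum i (F^~ l)).
Proof.
apply: Some_inj; rewrite !some_nesum.
under eq_bigr do rewrite some_nesum.
under [RHS]eq_bigr do rewrite some_nesum.
exact: exchange_big.
Qed.

Section MatrixAiSemiring.
Variables (S : aiSemiringType) (n : nat).
Implicit Types A B C : 'M[S]_n.

Definition mx_add A B : 'M[S]_n := \matrix_(i, j) (A i j + B i j).
Definition mx_mul A B : 'M[S]_n :=
  \matrix_(i, j) nesum i (fun k => A i k * B k j).

Fact mx_addA : associative mx_add.
Proof. by move=> A B C; apply/matrixP => i j; rewrite !mxE aiaddA. Qed.

Fact mx_addC : commutative mx_add.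
Proof. by move=> A B; apply/matrixP => i j; rewrite !mxE aiaddC. Qed.

Fact mx_addxx : idempotent_op mx_add.
Proof. by move=> A; apply/matrixP => i j; rewrite !mxE aiaddxx. Qed.

Fact mx_mulA : associative mx_mul.
Proof.
move=> A B C; apply/matrixP => i j; rewrite !mxE.
rewrite (eq_nesum _ (G := fun k => nesum i (fun l => A i k * (B k l * C l j)))).
  rewrite nesum_exchange; apply: eq_nesum => l; rewrite mxE nesum_mull.
  by apply: eq_nesum => k; rewrite aimulA.
by move=> k; rewrite mxE nesum_mulr (nesum_indep k i).
Qed.

Fact mx_mulDl : left_distributive mx_mul mx_add.
Proof.
move=> A B C; apply/matrixP => i j; rewrite !mxE -nesum_add.
by apply: eq_nesum => k; rewrite !mxE aimulDl.
Qed.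

Fact mx_mulDr : right_distributive mx_mul mx_add.
Proof.
move=> A B C; apply/matrixP => i j; rewrite !mxE -nesum_add.
by apply: eq_nesum => k; rewrite !mxE aimulDr.
Qed.

Fact mx_inhabited : inhabited 'M[S]_n.
Proof. by case: (@ai_inhabited S) => x; exists; exact: const_mx x. Qed.

HB.instance Definition _ := isAiSemiring.Build 'M[S]_n
  mx_addA mx_addC mx_addxx mx_mulA mx_mulDl mx_mulDr mx_inhabited.

End MatrixAiSemiring.

Definition Mx (n : nat) (S : aiSemiringType) : aiSemiringType := 'M[S]_n.

Section ProductAiSemiring.
Variables (I : Type) (S : I -> aiSemiringType).

Definition ai_prod := forall i, S i.
Implicit Types f g h : ai_prod.

Definition prod_add f g : ai_prod := fun i => f i + g i.
Definition prod_mul f g : ai_prod := fun i => f i * g i.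

Fact prod_addA : associative prod_add.
Proof. by move=> f g h; apply: functional_extensionality_dep => i; apply: aiaddA. Qed.

Fact prod_addC : commutative prod_add.
Proof. by move=> f g; apply: functional_extensionality_dep => i; apply: aiaddC. Qed.

Fact prod_addxx : idempotent_op prod_add.
Proof. by move=> f; apply: functional_extensionality_dep => i; apply: aiaddxx. Qed.

Fact prod_mulA : associative prod_mul.
Proof. by move=> f g h; apply: functional_extensionality_dep => i; apply: aimulA. Qed.

Fact prod_mulDl : left_distributive prod_mul prod_add.
Proof. by move=> f g h; apply: functional_extensionality_dep => i; apply: aimulDl. Qed.

Fact prod_mulDr : right_distributive prod_mul prod_add.
Proof. by move=> f g h; apply: functional_extensionality_dep => i; apply: aimulDr. Qed.

Fact prod_inhabited : inhabited ai_prod.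
Proof.
have inh i : exists x : S i, True by case: (@ai_inhabited (S i)) => x; exists x.
by exists=> i; apply: sval (cid (inh i)).
Qed.

HB.instance Definition _ := isAiSemiring.Build ai_prod
  prod_addA prod_addC prod_addxx prod_mulA prod_mulDl prod_mulDr prod_inhabited.

End ProductAiSemiring.

Definition ai_morphism (S T : aiSemiringType) (f : S -> T) : Prop :=
  {morph f : x y / x + y} /\ {morph f : x y / x * y}.

(* Classes of ai-semirings are plain predicates, compared extensionally: the
   [set] type of classical_sets lives in too small a universe to be applied to
   a type of structures that contains matrices. *)
Definition ai_class : Type := aiSemiringType -> Prop.

Definition subclass (V W : ai_class) : Prop := forall S, V S -> W S.
Definition eqclass (V W : ai_class) : Prop := forall S, V S <-> W S.

(* A variety is a class closed under homomorphic images, subalgebras and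
   products.  Subalgebras are taken up to isomorphism, as domains of injective
   morphisms; classes closed under homomorphic images are closed under
   isomorphism anyway. *)
Record variety (V : ai_class) : Prop := Variety {
  variety_hom : forall (S T : aiSemiringType) (f : S -> T),
    ai_morphism f -> (forall y, exists x, f x = y) -> V S -> V T;
  variety_sub : forall (S T : aiSemiringType) (f : S -> T),
    ai_morphism f -> injective f -> V T -> V S;
  variety_prod : forall (I : Type) (S : I -> aiSemiringType),
    (forall i, V (S i)) -> V (ai_prod S)
}.

Definition var_gen (K : ai_class) : ai_class :=
  fun S => forall V : ai_class, variety V -> subclass K V -> V S.

Definition Mvar (n : nat) (V : ai_class) : ai_class :=
  var_gen (fun T => exists2 S, V S & T = Mx n S).

Definition Rvar (n : nat) (W : ai_class) : ai_class := fun S => W (Mx n S).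

Definition matrix_stable (V : ai_class) : Prop :=
  forall n, 0 < n -> eqclass (Mvar n V) V.

Definition Core (W : ai_class) : ai_class :=
  fun S => forall k : nat, Rvar (2 ^ k) W S.

(* Main.v *)
Require Import Defs.
From mathcomp Require Import all_boot matrix.
From mathcomp Require Import boolp.

(** Everything rests on one remark: in an ai-semiring a nonempty finite sum is
    the least upper bound of its terms for the order [x <= y := x + y = y]
    ([nesum_leP]), so it depends only on the set of its terms, not on how often
    or in which arrangement they occur.  Hence there are, for all [S]:
    - an embedding of [S] into [M_n(S)] by constant matrices, since a product
      of constant matrices sums [n] copies of the same element
      ([const_mx_morph]);
    - an embedding of [M_a(S)] into [M_b(S)] for [0 < a <= b], which pulls
      matrices back along a surjection from [b] indices to [a] indices
      ([mxsub_morph]), that is, repeats rows and columns;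
    - the usual block isomorphism from [M_n(M_m(S))] to [M_{mn}(S)]
      ([unblock_morph]).
    The first gives [R_n(W) <= W], the second that [R_b(W) <= R_a(W)], the third
    that [R_m R_n = R_{mn}].  That [R_n(W)] is a variety holds because [M_n]
    preserves surjective and injective morphisms and embeds [M_n] of a product
    into the product of the [M_n]; the adjunction is then the universal property
    of the generated variety.

    For the core, every [M_n(S)] with [S] in [Core(W)] stays in [Core(W)]:
    [M_{2^k}(M_n(S))] is [M_{n 2^k}(S)] up to isomorphism, which embeds into
    [M_{2^(n+k)}(S)] because [n <= 2^n], and the latter lies in [W].  So powers
    of two control all matrix sizes.  Conversely a matrix-stable subvariety of
    [W] contains all matrix semirings over its members, whence it lies in every
    [R_{2^k}(W)]. *)

Set Implicit Arguments.
Unset Strict Implicit.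
Unset Printing Implicit Defensive.

(** * Finite sums as least upper bounds *)

Section Sums.
Local Open Scope ai_scope.
Variable S : aiSemiringType.
Implicit Types x y z : S.

Lemma aiadd_leP x y z : (x + y) + z = z <-> x + z = z /\ y + z = z.
Proof.
split=> [le_z | [le_x le_y]]; last by rewrite -aiaddA le_y.
split; rewrite -le_z; first by rewrite !aiaddA aiaddxx.
by rewrite (aiaddC x) !aiaddA aiaddxx.
Qed.

(** The universal property of a sum with idempotent addition; it is what makes
    repeated, rearranged and nested sums comparable. *)
Lemma nesum_leP (I : finType) (i : I) (F : I -> S) z :
  nesum i F + z = z <-> forall k, F k + z = z.
Proof.
split=> [le_z k | le_z].
  rewrite (nesum_indep i k) /nesum in le_z.
  move: le_z; elim/big_rec: _ => // l x _ IH /aiadd_leP[_]; exact: IH.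
by rewrite /nesum; elim/big_ind: _ => // x y le_x le_y; apply/aiadd_leP.
Qed.

(** Antisymmetry of the order, in the form that [nesum_leP] serves best: two
    elements with the same upper bounds agree. *)
Lemma ai_le_ext x y : (forall z, x + z = z <-> y + z = z) -> x = y.
Proof.
move=> eq_xy; have le_xy : x + y = y by apply/eq_xy; apply: aiaddxx.
have le_yx : y + x = x by apply/eq_xy; apply: aiaddxx.
by rewrite -le_yx aiaddC.
Qed.

Lemma nesum_surj (I J : finType) (p : J -> I) i j (F : I -> S) :
  (forall k, exists l, p l = k) -> nesum j (fun l => F (p l)) = nesum i F.
Proof.
move=> p_surj; apply: ai_le_ext => z; split=> /nesum_leP le_z.
  by apply/nesum_leP => k; have [l <-] := p_surj k.
by apply/nesum_leP.
Qed.

Lemma nesum_pair (I J : finType) i j (F : I * J -> S) :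
  nesum i (fun k => nesum j (fun l => F (k, l))) = nesum (i, j) F.
Proof.
apply: ai_le_ext => z; split=> /nesum_leP le_z; apply/nesum_leP.
  by case=> k l; move/nesum_leP: (le_z k); apply.
by move=> k; apply/nesum_leP.
Qed.

Lemma nesum_const (I : finType) (i : I) x : nesum i (fun=> x) = x.
Proof.
rewrite /nesum; elim/big_rec: _ => // k y _ ->; exact: aiaddxx.
Qed.

Lemma nesum_morph (T : aiSemiringType) (f : S -> T) (I : finType) (i : I) F :
  {morph f : x y / x + y} -> f (nesum i F) = nesum i (fun k => f (F k)).
Proof. by move=> fD; apply: (big_morph f). Qed.

End Sums.

(** * Morphisms between matrix semirings *)

Section MatrixMorphisms.
Local Open Scope ai_scope.
Implicit Types S T : aiSemiringType.

Lemma map_mx_morph n S T (f : S -> T) :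
  ai_morphism f -> @ai_morphism (Mx n S) (Mx n T) (@map_mx S T f n n).
Proof.
case=> fD fM; split=> A B; apply/matrixP => i j; rewrite !mxE //.
rewrite (nesum_morph _ _ fD); apply: eq_nesum => k.
by rewrite fM !mxE.
Qed.

(** A product of constant matrices sums one element repeatedly, which
    idempotence collapses.  Constant matrices thus take the place of the scalar
    matrices, which would require a zero in [S]. *)
Lemma const_mx_morph n S : @ai_morphism S (Mx n S) (@const_mx S n n).
Proof.
split=> x y; apply/matrixP => i j; rewrite !mxE //.
by rewrite (eq_nesum _ (G := fun=> x * y)) ?nesum_const // => k; rewrite !mxE.
Qed.

(** Repeating rows and columns along a surjection of the indices repeats the
    terms of each entry of a product, which does not change their sum. *)
Lemma mxsub_morph a b S (p : 'I_b -> 'I_a) :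
  (forall k, exists l, p l = k) ->
  @ai_morphism (Mx a S) (Mx b S) (@mxsub S a a b b p p).
Proof.
move=> p_surj; split=> A B; apply/matrixP => i j; rewrite !mxE //.
rewrite -(nesum_surj (p i) i (fun k => A (p i) k * B k (p j)) p_surj).
by apply: eq_nesum => k; rewrite !mxE.
Qed.

(** The numbering [q] is left arbitrary, so that nothing depends on how pairs of
    indices are ordered in the large matrix. *)
Definition unblock_mx n m N (S : Type) (q : 'I_N -> 'I_n * 'I_m)
    (A : 'M['M[S]_m]_n) : 'M[S]_N :=
  \matrix_(i, j) A (q i).1 (q j).1 (q i).2 (q j).2.

Lemma unblock_morph n m N S (q : 'I_N -> 'I_n * 'I_m) :
  (forall k, exists l, q l = k) ->
  @ai_morphism (Mx n (Mx m S)) (Mx N S) (@unblock_mx n m N S q).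
Proof.
move=> q_surj; split=> A B; apply/matrixP => i j; rewrite !mxE //.
(* Taking the [(i, j)] entry of a block commutes with sums of blocks. *)
rewrite (nesum_morph _ _ (f := fun C : Mx m S => (C : 'M[S]_m) (q i).2 (q j).2));
  last by move=> C D; rewrite mxE.
pose F k := A (q i).1 k.1 (q i).2 k.2 * B k.1 (q j).1 k.2 (q j).2.
transitivity (nesum (q i).1 (fun k => nesum (q i).2 (fun l => F (k, l)))).
  by apply: eq_nesum => k; rewrite mxE.
rewrite nesum_pair -surjective_pairing -(nesum_surj (q i) i F q_surj).
by apply: eq_nesum => k; rewrite !mxE.
Qed.

Lemma unblock_bij n m N (S : Type) (q : 'I_N -> 'I_n * 'I_m) :
  bijective q -> bijective (@unblock_mx n m N S q).
Proof.
case=> r qK rK.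
exists (fun B : 'M[S]_N => \matrix_(a, b) \matrix_(c, d) B (r (a, c)) (r (b, d)))%R => A.
  apply/matrixP => a b; apply/matrixP => c d.
  by rewrite !mxE !rK.
by apply/matrixP => i j; rewrite !mxE -!surjective_pairing !qK.
Qed.

Definition mx_prod n (I : Type) (S : I -> aiSemiringType)
    (A : Mx n (ai_prod S)) : ai_prod (fun i => Mx n (S i)) :=
  fun i => map_mx (fun f : ai_prod S => f i) A.

Lemma mx_prod_morph n (I : Type) (S : I -> aiSemiringType) :
  ai_morphism (@mx_prod n I S).
Proof.
have proj_morph i : @ai_morphism (ai_prod S) (S i) (fun f => f i) by split.
by split=> A B; apply: functional_extensionality_dep => i;
  have [fD fM] := map_mx_morph n (proj_morph i); [apply: fD | apply: fM].
Qed.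

Lemma mx_prod_inj n (I : Type) (S : I -> aiSemiringType) :
  injective (@mx_prod n I S).
Proof.
move=> A B eqAB; apply/matrixP => k l; apply: functional_extensionality_dep => i.
by have /matrixP/(_ k l) := congr1 (@^~ i) eqAB; rewrite !mxE.
Qed.

End MatrixMorphisms.

(** * The operators on varieties *)

Lemma var_gen_variety K : variety (var_gen K).
Proof.
split=> [S T f fM f_surj VS V varV KV | S T f fM f_inj VT V varV KV |
         I S VS V varV KV].
- exact: (variety_hom varV fM f_surj (VS V varV KV)).
- exact: (variety_sub varV fM f_inj (VT V varV KV)).
- by apply: (variety_prod varV) => i; apply: VS.
Qed.

Lemma Rvar_variety n W : variety W -> variety (Rvar n W).
Proof.
move=> varW; split.
- move=> S T f fM f_surj; apply: (variety_hom varW (map_mx_morph n fM)) => B.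
  have [g gK] := choice f_surj.
  by exists (map_mx g B); apply/matrixP => i j; rewrite !mxE gK.
- move=> S T f fM f_inj; apply: (variety_sub varW (map_mx_morph n fM)).
  move=> A B /matrixP eqAB; apply/matrixP => i j; apply: f_inj.
  by move: (eqAB i j); rewrite !mxE.
- move=> I S WS; apply: (variety_sub varW (@mx_prod_morph n I S)).
    exact: mx_prod_inj.
  exact: (variety_prod varW).
Qed.

Lemma Mx_Mvar n (V : ai_class) S : V S -> Mvar n V (Mx n S).
Proof. by move=> VS U _; apply; exists S. Qed.

Lemma Mvar_sub n V W :
  variety W -> subclass (Mvar n V) W <-> subclass V (Rvar n W).
Proof.
move=> varW; split=> [sMW S VS | sVR S MS].
  by apply: (sMW (Mx n S)); apply: Mx_Mvar.
by apply: MS => // _ [T VT ->]; apply: sVR.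
Qed.

Lemma Rvar_sub n W : 0 < n -> variety W -> subclass (Rvar n W) W.
Proof.
move=> n_gt0 varW S; apply: (variety_sub varW (const_mx_morph n S)) => x y.
by move/matrixP/(_ (Ordinal n_gt0) (Ordinal n_gt0)); rewrite !mxE.
Qed.

(** Larger matrix semirings satisfy fewer identities: they contain the smaller
    ones as subalgebras. *)
Lemma Rvar_anti a b W :
  0 < a <= b -> variety W -> subclass (Rvar b W) (Rvar a W).
Proof.
case: a => // a le_ab varW S.
(* The indices beyond [a] are all sent to [0] by [inord]. *)
pose p (i : 'I_b) : 'I_a.+1 := inord i.
have p_surj k : exists l, p l = k.
  by exists (widen_ord le_ab k); apply: inord_val.
apply: (variety_sub varW (mxsub_morph S p_surj)) => A B eqAB.
apply/matrixP => i j; have [[i' <-] [j' <-]] := (p_surj i, p_surj j).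
by move/matrixP/(_ i' j'): eqAB; rewrite !mxE.
Qed.

Lemma Rvar_comp m n W :
  variety W -> eqclass (Rvar m (Rvar n W)) (Rvar (m * n) W).
Proof.
(* [Rvar m (Rvar n W)] tests [M_n(M_m(S))]: the outer index is the [n] one. *)
move=> varW S; rewrite /Rvar mulnC.
have [q q_bij] : exists q : 'I_(n * m) -> 'I_n * 'I_m, bijective q.
  have [q fK qK] := curry_mxvec_bij n m.
  by exists q, (uncurry (@mxvec_index n m)) => k; [apply: qK | apply: fK].
have q_surj k : exists l, q l = k by case: q_bij => r _ rK; exists (r k).
have u_bij := @unblock_bij n m _ S q q_bij.
split; last exact: (variety_sub varW (unblock_morph S q_surj) (bij_inj u_bij)).
apply: (variety_hom varW (unblock_morph S q_surj)) => B.
by case: u_bij => g _ gK; exists (g B).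
Qed.

(** * The core *)

Lemma Core_variety W : variety W -> variety (Core W).
Proof.
move=> varW; split=> [S T f fM f_surj CS k | S T f fM f_inj CT k | I S CS k].
- exact: (variety_hom (Rvar_variety (2 ^ k) varW) fM f_surj (CS k)).
- exact: (variety_sub (Rvar_variety (2 ^ k) varW) fM f_inj (CT k)).
- by apply: (variety_prod (Rvar_variety (2 ^ k) varW)) => i; apply: CS.
Qed.

(** A matrix of size [2 ^ k] over [M_n(S)] is one of size [n * 2 ^ k] over [S],
    and this is at most the power of two [2 ^ (n + k)]. *)
Lemma Core_Mx n W : 0 < n -> variety W -> subclass (Core W) (Rvar n (Core W)).
Proof.
move=> n_gt0 varW S CS k; apply/(Rvar_comp n (2 ^ k) varW).
apply: (Rvar_anti _ varW (CS (n + k))).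
apply/andP; split; first by rewrite muln_gt0 n_gt0 expn_gt0.
by rewrite expnD leq_mul // ltnW // ltn_expl.
Qed.

Lemma Core_matrix_stable W : variety W -> matrix_stable (Core W).
Proof.
move=> varW n n_gt0 S; have varC := Core_variety varW; split; move: S.
  by apply/(Mvar_sub n (Core W) varC); apply: Core_Mx.
move=> S CS; apply: (Rvar_sub n_gt0 (var_gen_variety _)); exact: Mx_Mvar.
Qed.

Lemma Core_greatest U W : matrix_stable U -> subclass U W -> subclass U (Core W).
Proof.
move=> stU sUW S US k; apply: sUW.
by apply/(stU (2 ^ k)); [rewrite expn_gt0 | apply: Mx_Mvar].
Qed.

Theorem theorem9p3 :
  (forall n : nat, 0 < n ->
     (forall V : ai_class, variety V -> variety (Mvar n V)) /\
     (forall W : ai_class, variety W -> variety (Rvar n W)) /\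
     (forall V W : ai_class, variety V -> variety W ->
        (subclass (Mvar n V) W <-> subclass V (Rvar n W)))) /\
  (forall (m n : nat) (W : ai_class), 0 < m -> 0 < n -> variety W ->
     eqclass (Rvar m (Rvar n W)) (Rvar (m * n) W) /\
     subclass (Rvar n W) W) /\
  (forall W : ai_class, variety W ->
     [/\ variety (Core W), matrix_stable (Core W), subclass (Core W) W &
         forall U : ai_class, variety U -> matrix_stable U -> subclass U W ->
           subclass U (Core W)]).
Proof.
split; [move=> n n_gt0 | split; [move=> m n W m_gt0 n_gt0 varW | move=> W varW]].
- split; first by move=> V _; apply: var_gen_variety.
  split; first by move=> W; apply: Rvar_variety.
  by move=> V W _; apply: Mvar_sub.
- by split; [apply: Rvar_comp | apply: Rvar_sub].
split=> [||S CS|U _]; [exact: Core_variety | exact: Core_matrix_stable | |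
  exact: Core_greatest].
exact: (Rvar_sub _ varW (CS 0)).
Qed.
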